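(* Let $a, p, q$ be positive integers with $a > 1$ and $q \le p$, and let $\{G_n\}_{n=1}^{\infty}$ be the sequence defined by $G_1 = 1$, $G_2 = a$, and $G_n = pG_{n-1} + qG_{n-2}$ for $n > 2$. If $2 \le a \le p+q$, then $\{G_n\}_{n=1}^{\infty}$ is totally greedy.
   Context: Let $S = \{s_1 = 1, s_2, \ldots, s_t\}$ be a set of integers (coin denominations) listed with $1 = s_1 < s_2 < \cdots < s_t$. For an integer $k \ge 0$, a payment vector for $k$ is a vector $(a_1, \ldots, a_t)$ of nonnegative integers with $\sum_{i=1}^t a_i s_i = k$; it is optimal if $\sum_{i=1}^t a_i$ is minimal among all payment vectors for $k$. The greedy payment vector for $k$ is obtained by running, for $i = t, t-1, \ldots, 1$: $a_i := \lfloor k/s_i \rfloor$, then replace $k$ by $k \bmod s_i$. The set $S$ is called greedy if for every integer $k \ge 0$ the greedy payment vector for $k$ is optimal. An integer sequence $\{s_n\}_{n=1}^\infty$ with $s_1 = 1$ and $s_i < s_{i+1}$ for all $i$ is called totally greedy if every prefix subset $\{1, s_2, \ldots, s_k\}$ is greedy. *)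

(* Defs.v *)
From mathcomp Require Import all_boot.

Set Implicit Arguments.
Unset Strict Implicit.
Unset Printing Implicit Defensive.

(* A finite coin set is given by the increasing list [:: s_1; ...; s_t] of its
   elements; nth 0 S i is s_(i+1). *)
Definition coin_set (S : seq nat) : Prop := head 0 S = 1 /\ sorted ltn S.

Definition payment_vector (S : seq nat) (k : nat) (a : seq nat) : Prop :=
  size a = size S /\ \sum_(i < size S) nth 0 a i * nth 0 S i = k.

Definition optimal_payment (S : seq nat) (k : nat) (a : seq nat) : Prop :=
  payment_vector S k a /\
  forall b : seq nat, payment_vector S k b -> sumn a <= sumn b.

(* Coins and coefficients are listed here from the largest coin down. *)
Fixpoint greedy_down (r : seq nat) (k : nat) : seq nat :=
  if r is s :: r' then k %/ s :: greedy_down r' (k %% s) else [::].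

Definition greedy_payment (S : seq nat) (k : nat) : seq nat :=
  rev (greedy_down (rev S) k).

Definition greedy (S : seq nat) : Prop :=
  coin_set S /\ forall k : nat, optimal_payment S k (greedy_payment S k).

(* Sequences are indexed from 1; the value s 0 is irrelevant. *)
Definition coin_prefix (s : nat -> nat) (k : nat) : seq nat :=
  [seq s i | i <- iota 1 k].

Definition totally_greedy (s : nat -> nat) : Prop :=
  [/\ s 1 = 1,
      forall i : nat, 1 <= i -> s i < s i.+1
    & forall k : nat, 1 <= k -> greedy (coin_prefix s k)].

(* Main.v *)
(** Write c_S(k) for the number of coins greedy uses to pay k. If c_S is
    subadditive and gives every coin of S cost at most 1, then it is at most the
    number of coins of any payment, so S is greedy. Both properties pass from S,
    with largest coin s, to S extended by a coin s' as soon as m s = s' + d with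
    c_S(d) < m: for every w,
      c_S(w) + m = c_S(w + m s) <= c_S(s' + w) + c_S(d),
    hence c_S(w) < c_S(s' + w), and using s' never costs more than avoiding it.
    For s = G_n, s' = G_(n+1) and n >= 3 one takes m = p + 1, because
      (p + 1) G_n - G_(n+1) = G_n - q G_(n-1) = (p - q) G_(n-1) + q G_(n-2)
    is payable with p coins; for n = 2 one takes m = p + floor(q / a) + 1, with
    d = a - (q mod a) paid in ones, and for n = 1, m = a and d = 0. *)

Require Import Defs.
From mathcomp Require Import all_boot zify.

(** The list [r] runs from the largest coin down, so a new largest coin is a cons. *)
Definition greedy_cost (r : seq nat) (k : nat) : nat := sumn (greedy_down r k).

Definition subadditive_cost (r : seq nat) : Prop :=
  (forall x y, greedy_cost r (x + y) <= greedy_cost r x + greedy_cost r y) /\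
  (forall s, s \in r -> greedy_cost r s <= 1).

Lemma greedy_cost_cons s r k :
  greedy_cost (s :: r) k = k %/ s + greedy_cost r (k %% s).
Proof. by []. Qed.

Lemma greedy_cost0 r : greedy_cost r 0 = 0.
Proof. by elim: r => // s r IH; rewrite greedy_cost_cons div0n mod0n IH. Qed.

Lemma greedy_cost_top s r m w : 0 < s ->
  greedy_cost (s :: r) (m * s + w) = m + greedy_cost (s :: r) w.
Proof.
by move=> s_gt0; rewrite !greedy_cost_cons divnMDl // modnMDl addnA.
Qed.

Lemma subadditive_cost_mul r : subadditive_cost r ->
  forall s n, s \in r -> greedy_cost r (n * s) <= n.
Proof.
move=> [sub le1] s n rs; elim: n => [|n IH]; first by rewrite greedy_cost0.
by rewrite mulSn -add1n (leq_trans (sub _ _)) // leq_add // le1.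
Qed.

Lemma subadditive_cost1 : subadditive_cost [:: 1].
Proof.
have cost1 k : greedy_cost [:: 1] k = k.
  by rewrite greedy_cost_cons divn1 addn0.
by split=> [x y|s]; rewrite !cost1 // inE => /eqP->.
Qed.

Lemma subadditive_cost_cons s' s r m d :
  0 < s -> 0 < s' -> m * s = s' + d -> greedy_cost (s :: r) d < m ->
  subadditive_cost (s :: r) -> subadditive_cost (s' :: s :: r).
Proof.
move=> s_gt0 s'_gt0 def_m cost_d [sub le1].
have remove1 w : (greedy_cost (s :: r) w).+1 <= greedy_cost (s :: r) (s' + w).
  have := sub (s' + w) d; rewrite addnAC -def_m greedy_cost_top //; lia.
have remove j w :
    j + greedy_cost (s :: r) w <= greedy_cost (s :: r) (j * s' + w).
  elim: j => // j IH; rewrite mulSn -addnA.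
  exact: leq_trans (remove1 _).
have le_cost x : greedy_cost (s' :: s :: r) x <= greedy_cost (s :: r) x.
  by rewrite greedy_cost_cons {3}(divn_eq x s') remove.
split=> [x y|c].
  (* The copies of [s'] cancel. The two remainders may add up to [s'] or more, so [le_cost] moves
     their sum to [s :: r], where [sub] applies. *)
  rewrite {1}(divn_eq x s') {1}(divn_eq y s') addnACA -mulnDl.
  rewrite greedy_cost_top // (greedy_cost_cons s' _ x) (greedy_cost_cons s' _ y).
  rewrite addnACA leq_add2l.
  exact: leq_trans (le_cost _) (sub _ _).
rewrite in_cons => /predU1P[->|rc]; last exact: leq_trans (le_cost c) (le1 c rc).
by rewrite greedy_cost_cons divnn modnn greedy_cost0 s'_gt0.
Qed.

Lemma size_greedy_down r k : size (greedy_down r k) = size r.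
Proof. by elim: r k => //= s r IH k; rewrite IH. Qed.

Lemma greedy_down_value r k : last 0 r = 1 ->
  \sum_(i < size r) nth 0 (greedy_down r k) i * nth 0 r i = k.
Proof.
elim: r k => //= s r IH k last1; rewrite big_ord_recl /=.
case: r => [|s2 r] in IH last1 *; last by rewrite IH // -divn_eq.
by rewrite big_ord0 [s]last1 divn1 muln1 addn0.
Qed.

(** Each block of equal coins in the payment [b] costs greedy at most its number of coins;
    subadditivity adds these bounds. *)
Lemma greedy_cost_le r b : subadditive_cost r -> size b = size r ->
  greedy_cost r (\sum_(i < size r) nth 0 b i * nth 0 r i) <= sumn b.
Proof.
move=> sub_r size_b; rewrite sumnE (big_nth 0) big_mkord size_b.
elim/big_ind2: _ => [|x1 x2 y1 y2 le1 le2|i _]; first by rewrite greedy_cost0.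
  by have [sub _] := sub_r; rewrite (leq_trans (sub _ _)) // leq_add.
by apply: subadditive_cost_mul => //; rewrite mem_nth.
Qed.

Lemma payment_vector_rev S k b :
  payment_vector S k b -> payment_vector (rev S) k (rev b).
Proof.
move=> [size_b val_b]; split; first by rewrite !size_rev.
rewrite size_rev -val_b (reindex_inj rev_ord_inj) /=.
apply: eq_bigr => i _; have lt_i := ltn_ord i.
rewrite !nth_rev ?size_b; try lia.
by congr (nth _ _ _ * nth _ _ _); lia.
Qed.

Lemma greedy_subadditive S :
  coin_set S -> subadditive_cost (rev S) -> greedy S.
Proof.
move=> coinS subS; split=> // k; have [head1 _] := coinS.
have last1 : last 0 (rev S) = 1.
  by case: (S) head1 => //= s S' ->; rewrite rev_cons last_rcons.
split.
  rewrite -[S in payment_vector S]revK; apply: payment_vector_rev.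
  by split; [rewrite size_greedy_down | rewrite greedy_down_value].
move=> b /payment_vector_rev[size_b <-].
by rewrite sumn_rev -(sumn_rev b) greedy_cost_le.
Qed.

Lemma rev_coin_prefixS s k :
  rev (coin_prefix s k.+1) = s k.+1 :: rev (coin_prefix s k).
Proof. by rewrite /coin_prefix -(addn1 k) iotaD map_cat rev_cat addnC. Qed.

Lemma coin_set_prefix s k : s 1 = 1 ->
  (forall i, 1 <= i -> s i < s i.+1) -> 1 <= k -> coin_set (coin_prefix s k).
Proof.
move=> s1 s_lt; case: k => // k _; split=> //.
(* Indices are restricted to [1 <= i] because [s 0] is arbitrary. *)
apply: (homo_sorted_in (P := [pred i | 1 <= i]) (e := ltn)).
- move=> i j; rewrite !inE /= => i_gt0 _.
  elim: j => // j IH; rewrite ltnS leq_eqVlt => /predU1P[<-|lt_ij].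
    exact: s_lt.
  by apply: ltn_trans (IH lt_ij) (s_lt _ _); lia.
- by apply/allP=> i; rewrite mem_iota => /andP[].
- exact: iota_ltn_sorted.
Qed.

Theorem theorem2 (a p q : nat) (ha : 0 < a) (hp : 0 < p) (hq : 0 < q)
    (ha1 : 1 < a) (hqp : q <= p)
    (G : nat -> nat) (hG1 : G 1 = 1) (hG2 : G 2 = a)
    (hG : forall n : nat, 2 < n -> G n = p * G (n - 1) + q * G (n - 2)) :
  2 <= a <= p + q -> totally_greedy G.
Proof.
move=> /andP[_ le_a].
have GE n : G n.+3 = p * G n.+2 + q * G n.+1.
  by rewrite hG // subn1 subn2.
have G_mono n : 0 < G n.+1 < G n.+2.
  by elim: n => [|n IH]; [rewrite hG1 hG2 | rewrite GE; nia].
have G_gt0 n : 0 < G n.+1 by case/andP: (G_mono n).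
have G_lt i : 1 <= i -> G i < G i.+1.
  by case: i => // i _; case/andP: (G_mono i).
split=> // k k_gt0; apply: greedy_subadditive; first exact: coin_set_prefix.
case: k k_gt0 => // k _; elim: k => [|k IH].
  by rewrite /coin_prefix /= hG1; apply: subadditive_cost1.
move: IH; rewrite !rev_coin_prefixS => IH.
have [sub _] := IH; have mulc := subadditive_cost_mul _ IH.
case: k IH sub mulc => [|[|k]] IH sub mulc.
- apply: (subadditive_cost_cons _ _ _ a 0) IH; rewrite ?greedy_cost0 //.
  by rewrite hG1 hG2 muln1 addn0.
- apply: (subadditive_cost_cons _ _ _ (p + q %/ a + 1) (a - q %% a)) IH => //.
    rewrite GE hG1 hG2; have := divn_eq q a; have := ltn_pmod q ha.
    by move: (q %/ a) (q %% a) => t u; rewrite !mulnDl; lia.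
  have := mulc 1 (a - q %% a); rewrite muln1 => le_cost.
  apply: leq_ltn_trans (le_cost _) _.
    by rewrite /coin_prefix /= hG1 !inE orbT.
  (* If [q < a], the bound reads [a - q < p + 1], which is [a <= p + q]; otherwise [a <= q <= p]
     suffices. *)
  have [lt_qa | le_aq] := ltnP q a.
    by rewrite modn_small // divn_small //; lia.
  by move: (q %/ a) (q %% a) => t u; lia.
- apply: (subadditive_cost_cons _ _ _ p.+1 ((p - q) * G k.+2 + q * G k.+1)) IH => //.
    by rewrite (GE k.+1) mulSn [in X in X + _ = _]GE; nia.
  (* The bound [p] splits as [p - q] copies of [G k.+2] plus [q] copies of [G k.+1]. *)
  rewrite ltnS (leq_trans (sub _ _)) // -{2}(subnK hqp).
  by apply: leq_add; apply: mulc; rewrite !rev_coin_prefixS !inE eqxx ?orbT.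
Qed.
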